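(* Let $\Gamma=(V,E)$ be a connected graph with $V$ countable and every vertex of finite valence, and let $d$ be the graph metric on $V$. Suppose that for every $n\in\mathbb{N}$ there is a number $M_n$ such that every rigid triple $\{x,y,z\}$ in $\Gamma$ with $d(x,y)=n$ has perimeter $d(x,y)+d(y,z)+d(z,x)\le M_n$. Then every point of the metric boundary $\partial_d V$ is a Busemann point.
   Context: Graphs are undirected. For a connected graph $\Gamma=(V,E)$, the graph metric $d$ on $V$ is $d(x,y)=$ the minimum length (number of edges) of a path from $x$ to $y$; a minimal path from $x$ to $y$ is a path of length $d(x,y)$. A rigid triple is a set of $3$ vertices such that if $x$ is any one of these vertices, and $y$ and $z$ are the other two, then there are no minimal paths from $x$ to $y$ and from $x$ to $z$ which share a vertex other than $x$. Metric compactification: for a complete, locally compact metric space $(X,d)$, let $C_b(X)$ be the commutative unital C*-algebra of bounded continuous functions on $X$ with the uniform norm, and $C_\infty(X)$ the closed subalgebra of functions vanishing at infinity. For $y,z\in X$ let $\varphi_{y,z}(x)=d(x,y)-d(x,z)$, which lies in $C_b(X)$. Let $\mathcal{G}(X,d)$ be the closed (C*-)subalgebra of $C_b(X)$ generated by $C_\infty(X)$, the constant functions and all $\varphi_{y,z}$, $y,z\in X$. The metric compactification $\overline{X}_d$ is the maximal ideal space (Gelfand spectrum) of $\mathcal{G}(X,d)$; it is compact and contains $X$ as an open subset via point evaluations. The metric boundary is $\partial_d X=\overline{X}_d\setminus X$. For a connected graph this is applied to $X=V$ with the graph metric. Let $T$ be an unbounded subset of $\mathbb{R}^+=[0,\infty)$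 containing $0$. A map $\gamma:T\to X$ is an almost-geodesic ray if for every $\varepsilon>0$ there is an integer $N$ such that $|d(\gamma(t),\gamma(s))+d(\gamma(s),\gamma(0))-t|<\varepsilon$ for all $t,s\in T$ with $t\ge s\ge N$. The ray $\gamma$ converges to $\omega\in\partial_d X$ if $\gamma(t)\to\omega$ in $\overline{X}_d$ as $t\to\infty$ in $T$. A point of $\partial_d X$ is a Busemann point if it is the limit of an almost-geodesic ray. *)

(* Defs.v *)
From HB Require Import structures.
From mathcomp Require Import all_boot all_order all_algebra.
From mathcomp Require Import all_classical all_reals all_analysis.
From mathcomp Require Import complex.

Set Implicit Arguments.
Unset Strict Implicit.
Unset Printing Implicit Defensive.

Import Order.TTheory GRing.Theory Num.Theory.
Import numFieldNormedType.Exports.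

Local Open Scope classical_set_scope.
Local Open Scope complex_scope.
Local Open Scope ring_scope.

(* The complex numbers. The regular algebra R[i]^o, unlike R[i], carries the
   topology of the modulus. *)
Notation Cplx R := (R[i]^o) (only parsing).

Section MetricAlgebra.
Context {R : realType} (X : metricType R).
Implicit Types (f g : X -> Cplx R) (A : set (X -> Cplx R)).

Definition bounded_continuous : set (X -> Cplx R) :=
  [set f | continuous f /\ bounded_fun f].

(* The order of R[i] makes 0 < e mean that e is a positive real. *)
Definition vanishing_at_infinity : set (X -> Cplx R) :=
  [set f | continuous f /\
     forall e : Cplx R, 0 < e ->
       exists2 K : set X, compact K & forall x, ~ K x -> `|f x| < e].

Definition dist_diff (y z : X) : X -> Cplx R :=
  fun x => (mdist x y - mdist x z)%:C.

(* The uniform structure of {uniform X -> _} induces, on bounded functions, the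
   topology of the uniform norm. *)
Record cstar_subalgebra A : Prop := CstarSubalgebra {
  cstar_sub_bounded_continuous : A `<=` bounded_continuous;
  cstar_sub1 : A 1;
  cstar_subZD : forall (a : R[i]) f g, A f -> A g -> A (a *: f + g);
  cstar_subM : forall f g, A f -> A g -> A (f * g);
  cstar_sub_conj : forall f, A f -> A (fun x => (f x)^*);
  cstar_sub_closed : closed (A : set {uniform X -> Cplx R})
}.

Definition metric_algebra_set : set (X -> Cplx R) :=
  smallest cstar_subalgebra
    (vanishing_at_infinity `|` range (fun c : Cplx R => cst c)
     `|` [set dist_diff yz.1 yz.2 | yz in [set: X * X]]).

Definition in_metric_algebra : {pred (X -> Cplx R)} := mem metric_algebra_set.

Lemma metric_algebra_subring : GRing.subring_closed in_metric_algebra.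
Proof.
split=> [|f g /set_mem Gf /set_mem Gg|f g /set_mem Gf /set_mem Gg];
  apply/mem_set => A [cA GA]; first exact: cstar_sub1 cA.
- rewrite -scaleN1r addrC.
  by apply: (cstar_subZD cA); [exact: Gg|exact: Gf].
- by apply: (cstar_subM cA); [exact: Gf|exact: Gg].
Qed.

Lemma metric_algebra_scaler : GRing.scaler_closed in_metric_algebra.
Proof.
move=> a f /set_mem Gf; apply/mem_set => A [cA GA].
have A0 : A 0.
  have := cstar_subZD cA (- 1) (cstar_sub1 cA) (cstar_sub1 cA).
  by rewrite scaleN1r addNr.
by rewrite -[_ *: _]addr0; apply: (cstar_subZD cA) => //; exact: Gf.
Qed.

HB.instance Definition _ :=
  GRing.isSubringClosed.Build _ in_metric_algebra metric_algebra_subring.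
HB.instance Definition _ :=
  GRing.isScaleClosed.Build _ _ in_metric_algebra metric_algebra_scaler.

Definition metric_algebra : Type := {f : X -> Cplx R | in_metric_algebra f}.

HB.instance Definition _ := SubChoice.on metric_algebra.
HB.instance Definition _ :=
  GRing.SubChoice_isSubComPzRing.Build _ _ metric_algebra
    metric_algebra_subring.
HB.instance Definition _ := [SubZmodule_isSubLmodule of metric_algebra by <:].

(* The Gelfand spectrum of G(X, d), i.e. its unital multiplicative linear
   functionals, as a subspace of {ptws _ -> _}: the topology of pointwise
   convergence is the weak-* topology. *)
Definition metric_compactification : set {ptws metric_algebra -> Cplx R} :=
  [set w | linear (w : metric_algebra -> Cplx R) /\
           GRing.monoid_morphism (w : metric_algebra -> Cplx R)].

Definition point_eval (x : X) : {ptws metric_algebra -> Cplx R} :=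
  fun f : metric_algebra => (\val f : X -> Cplx R) x.

Lemma point_eval_compactification x : metric_compactification (point_eval x).
Proof. by split. Qed.

Definition metric_boundary : set {ptws metric_algebra -> Cplx R} :=
  metric_compactification `\` range point_eval.

(* Only the values of gamma on T matter; gamma is extended arbitrarily
   outside T. *)
Definition almost_geodesic_ray (T : set R) (gamma : R -> X) : Prop :=
  [/\ T `<=` [set t | 0 <= t], ~ has_ubound T, T 0 &
      forall e : R, 0 < e -> exists N : nat, forall t s : R,
        T t -> T s -> s <= t -> N%:R <= s ->
        `|mdist (gamma t) (gamma s) + mdist (gamma s) (gamma 0) - t| < e].

Definition ray_converges_to (T : set R) (gamma : R -> X)
    (w : {ptws metric_algebra -> Cplx R}) : Prop :=
  point_eval (gamma t) @[t --> within T (pinfty_nbhs R)] --> w.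

Definition busemann_point (w : {ptws metric_algebra -> Cplx R}) : Prop :=
  metric_boundary w /\
  exists (T : set R) (gamma : R -> X),
    almost_geodesic_ray T gamma /\ ray_converges_to T gamma w.

End MetricAlgebra.

(* An undirected graph is a type V of vertices with a symmetric adjacency
   relation e. *)
Section Graph.
Context (V : choiceType) (e : rel V).

Definition walk (x y : V) (p : seq V) : bool :=
  path e x p && (last x p == y).

Definition graph_connected : Prop := forall x y, exists p, walk x y p.

Definition locally_finite : Prop := forall x, finite_set [set y | e x y].

Lemma walk_length_ex (ec : graph_connected) (x y : V) :
  exists n, `[< exists2 p, walk x y p & size p = n >].
Proof. by have [p xpy] := ec x y; exists (size p); apply/asboolP; exists p. Qed.

Definition graph_dist (ec : graph_connected) (x y : V) : nat :=
  ex_minn (walk_length_ex ec x y).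

(* The vertices of the path p from x are those of x :: p. *)
Definition minimal_path (ec : graph_connected) (x y : V) (p : seq V) : Prop :=
  walk x y p /\ size p = graph_dist ec x y.

Definition minimal_paths_meet_only_at_start (ec : graph_connected)
    (x y z : V) : Prop :=
  forall p q v, minimal_path ec x y p -> minimal_path ec x z q ->
    v \in x :: p -> v \in x :: q -> v = x.

Definition rigid_triple (ec : graph_connected) (x y z : V) : Prop :=
  uniq [:: x; y; z] /\
  [/\ minimal_paths_meet_only_at_start ec x y z,
      minimal_paths_meet_only_at_start ec y x z &
      minimal_paths_meet_only_at_start ec z x y].

Lemma graph_dist_walk (ec : graph_connected) x y :
  exists2 p, walk x y p & size p = graph_dist ec x y.
Proof. by rewrite /graph_dist; case: ex_minnP => n /asboolP. Qed.

Lemma graph_dist_le (ec : graph_connected) x y p :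
  walk x y p -> (graph_dist ec x y <= size p)%N.
Proof.
rewrite /graph_dist; case: ex_minnP => n _ nmin xpy.
by apply: nmin; apply/asboolP; exists p.
Qed.

Lemma graph_distxx (ec : graph_connected) x : graph_dist ec x x = 0%N.
Proof.
by apply/eqP; rewrite -leqn0; apply: (@graph_dist_le _ _ _ [::]); rewrite /walk/=.
Qed.

Lemma graph_dist_eq0 (ec : graph_connected) x y :
  graph_dist ec x y = 0%N -> x = y.
Proof.
have [p /andP[_ /eqP <-] <-] := graph_dist_walk ec x y.
by move=> /size0nil ->.
Qed.

Lemma graph_dist_triangle (ec : graph_connected) y x z :
  (graph_dist ec x z <= graph_dist ec x y + graph_dist ec y z)%N.
Proof.
have [p /andP[xp /eqP py] <-] := graph_dist_walk ec x y.
have [q /andP[yq qz] <-] := graph_dist_walk ec y z.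
rewrite -size_cat; apply: graph_dist_le.
by rewrite /walk cat_path last_cat xp py yq.
Qed.

Context (es : symmetric e).

Lemma graph_dist_sym (ec : graph_connected) x y :
  graph_dist ec x y = graph_dist ec y x.
Proof.
suff le u v : (graph_dist ec u v <= graph_dist ec v u)%N.
  by apply/eqP; rewrite eqn_leq !le.
have [p /andP[vp /eqP <-] <-] := graph_dist_walk ec v u.
rewrite -(size_belast v p) -size_rev; apply: graph_dist_le.
rewrite /walk (eq_path (e' := fun z => e^~ z)) ?rev_path ?vp//=.
by case: p vp => //= a p _; rewrite rev_cons last_rcons.
Qed.

End Graph.

(* An alias of V carrying the graph metric; R is a parameter so that the type
   determines its metric structure. *)
Definition graph_space (R : realType) (V : choiceType) (e : rel V)
  (es : symmetric e) (ec : graph_connected e) : Type := V.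

Section GraphSpace.
Context (R : realType) (V : choiceType) (e : rel V).
Context (es : symmetric e) (ec : graph_connected e).

Let dist (x y : graph_space R es ec) : R := (graph_dist ec x y)%:R.

Let distxx x : dist x x = 0.
Proof. by rewrite /dist graph_distxx. Qed.

Let dist_positivity x y : dist x y = 0 -> x = y.
Proof. by move/eqP; rewrite pnatr_eq0 => /eqP/graph_dist_eq0. Qed.

Let dist_sym x y : dist x y = dist y x.
Proof. by rewrite /dist (graph_dist_sym es). Qed.

Let dist_triangle y x z : dist x z <= dist x y + dist y z.
Proof. by rewrite -natrD ler_nat graph_dist_triangle. Qed.

HB.instance Definition _ := Choice.copy (graph_space R es ec) V.
HB.instance Definition _ := isMetric.Build R (graph_space R es ec)
  distxx dist_positivity dist_sym dist_triangle.

End GraphSpace.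

(* Main.v *)
Require Import Defs.
From mathcomp Require Import all_boot all_order all_algebra.
From mathcomp Require Import all_classical all_reals all_analysis.
From mathcomp Require Import complex zify ring lra.

(** Write d for the graph distance and G for the algebra of the metric
    compactification.

    A boundary point w is a character of G that is not an evaluation.  On
    finitely many elements of G it is approximated by evaluations at vertices
    [character_approx]: otherwise the sum of the |f_i - w f_i|^2 is bounded
    below by a positive constant, hence invertible in G [cstar_inv], although w
    kills it.  Applied to point masses, which w kills, and to the differences
    d(-, y) - d(-, x0), whose values are integers, this attaches to w an
    integer-valued horofunction h: for every finite set F of vertices there are
    x outside F with d(x, y) - d(x, z) = h(y) - h(z) for all y, z in F
    [boundary_horofunction].  Call such x deep for F.

    Conversely h determines w.  The functions whose oscillation on the deep
    vertices of F tends to 0 as F grows form a C*-algebra containing the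
    generators of G [cstar_oscillation_algebra, metric_algebra_oscillation], so
    a ray that is eventually deep for every F converges to w.

    It remains to construct such a ray as a geodesic.  Say that b is below a if
    h(a) - h(b) = d(a, b), that is, if b lies on a minimal path from a to deep
    vertices.  This is a partial order.  A strictly descending sequence of
    vertices is geodesic, and it is eventually deep for every F as soon as it is
    eventually below each vertex.  Since V is countable and no vertex is minimal
    [below_strict], such a sequence exists once any two vertices have a common
    lower bound [busemann_sequence].

    Common lower bounds are what the condition on rigid triples provides
    [common_below].  Suppose that y, z have none and are at minimal distance
    among such pairs.  For x deep, let v be the vertex furthest from x that lies
    on a minimal path from x to y and on one from x to z.  Then {y, z, v} is
    rigid: a vertex shared at the corner y would be below y and closer to z, so
    by minimality of d(y, z) it would have a common lower bound with z, which
    would also be below y.  Hence v lies in a ball about y whose radius depends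
    only on d(y, z).  If x is deep for that ball, v is below both y and z. *)

Set Implicit Arguments.
Unset Strict Implicit.
Unset Printing Implicit Defensive.

Import Order.TTheory GRing.Theory Num.Theory.
Import numFieldNormedType.Exports.

Local Open Scope classical_set_scope.
Local Open Scope ring_scope.

(** * Horofunctions on a graph *)

Section Geodesics.
Context (V : choiceType) (e : rel V).
Context (es : symmetric e) (ec : graph_connected e).
Local Notation d := (graph_dist ec).

Lemma minimal_path_split x y p v : minimal_path ec x y p -> v \in x :: p ->
  (d x v + d v y = d x y)%N.
Proof.
move=> [+ sp] vp; case/splitPl: p / vp sp => p1 p2 lastp1.
rewrite /walk cat_path last_cat lastp1 size_cat => sp.
move=> /andP[/andP[p1P p2P] lastp2].
have le1 : (d x v <= size p1)%N.
  by apply: graph_dist_le; rewrite /walk p1P lastp1 eqxx.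
have le2 : (d v y <= size p2)%N by apply: graph_dist_le; rewrite /walk p2P.
by apply/eqP; rewrite eqn_leq graph_dist_triangle -sp leq_add.
Qed.

Lemma minimal_path_step x y : x != y ->
  exists2 z, e x z & d x y = (d z y).+1.
Proof.
move=> xy; have [[|z p] /andP[/= + /eqP pl] sp] := graph_dist_walk ec x y.
  by rewrite pl eqxx in xy.
move=> /andP[xz zp]; exists z => //; apply/eqP; rewrite -sp eqn_leq ltnS.
have dzy : (d z y <= size p)%N.
  by apply: graph_dist_le; rewrite /walk zp pl eqxx.
have xz1 : (d x z <= 1)%N.
  by apply: (@graph_dist_le _ _ _ _ _ [:: z]); rewrite /walk /= xz eqxx.
by have := graph_dist_triangle ec z x y; rewrite -sp /=; lia.
Qed.

Lemma graph_ball_finite (elf : locally_finite e) n x :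
  exists F : seq V, forall y, (d x y <= n)%N -> y \in F.
Proof.
elim: n x => [|n IHn] x.
  by exists [:: x] => y; rewrite leqn0 inE => /eqP /graph_dist_eq0 ->.
have /choice[F FP] :
    forall z, exists F : seq V, forall y, (d z y <= n)%N -> y \in F.
  exact: IHn.
have /finite_seqP[N NE] := elf x.
exists (x :: flatten [seq F z | z <- N]) => y dxy; rewrite inE.
have [//|] := eqVneq y x; rewrite eq_sym => /minimal_path_step[z xz dE] /=.
apply/flatten_mapP; exists z; last by apply: FP; rewrite dE in dxy.
by have : [set y | e x y] z by []; rewrite NE.
Qed.

(** The vertices that see F exactly as a point at infinity with horofunction h
    does; membership in F is excluded so that they leave every finite set. *)
Definition deep (h : V -> int) (F : seq V) (x : V) : Prop :=
  x \notin F /\ {in F &, forall y z, (d x y)%:Z - (d x z)%:Z = h y - h z}.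

Definition horofunction (h : V -> int) : Prop :=
  forall F : seq V, exists x, deep h F x.

(** The order in which b lies on a minimal path from a towards the point at
    infinity with horofunction h. *)
Definition below (h : V -> int) (b a : V) : Prop := h a - h b = (d a b)%:Z.

(** Deep vertices stand for the point at infinity, so what lies between them and
    a lies below a. *)
Lemma deep_below h F x a b : deep h F x -> a \in F -> b \in F ->
  (d x b + d b a = d x a)%N -> below h b a.
Proof.
by move=> [_ Fx] aF bF dE; rewrite /below (graph_dist_sym es) -(Fx a b)//; lia.
Qed.

Lemma below_refl h a : below h a a.
Proof. by rewrite /below graph_distxx subrr. Qed.

Section Horofunction.
Context (h : V -> int) (hh : horofunction h).

Lemma horofunction_lipschitz a b : h a - h b <= (d a b)%:Z.
Proof.
have [x [_ /(_ a b)]] := hh [:: a; b].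
rewrite !inE !eqxx orbT => /(_ isT isT) <-.
have := graph_dist_triangle ec b x a.
by rewrite (graph_dist_sym es ec b a); lia.
Qed.

Lemma below_trans a b c : below h c b -> below h b a -> below h c a.
Proof.
rewrite /below => cb ba.
have := graph_dist_triangle ec b a c; have := horofunction_lipschitz a c.
by lia.
Qed.

(** The first step of a minimal path from a to a vertex that is deep for the
    unit ball about a goes down. *)
Lemma below_strict (elf : locally_finite e) a :
  exists b, below h b a /\ h b < h a.
Proof.
have [F FP] := graph_ball_finite elf 1 a.
have [x Fx] := hh F.
have aF : a \in F by apply: FP; rewrite graph_distxx.
have ax : a != x by apply: contraTneq aF => ->; exact: Fx.1.
have [b ab dE] := minimal_path_step ax.
have dab : (d a b <= 1)%N.
  by apply: (@graph_dist_le _ _ _ _ _ [:: b]); rewrite /walk /= ab eqxx.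
have bF : b \in F by exact: FP.
have := Fx.2 a b aF bF; have := horofunction_lipschitz a b; rewrite /below.
rewrite (graph_dist_sym es ec x a) (graph_dist_sym es ec x b) => lab hab.
by exists b; split; lia.
Qed.

(** A pair without common lower bound, at minimal distance, forms a rigid triple
    with the vertex v where the minimal paths to a deep vertex x separate.  The
    bound on the perimeter keeps v in a ball known in advance, and x can be
    chosen deep for that ball, so that v is a common lower bound. *)
Lemma common_below (elf : locally_finite e)
    (rigid : forall n : nat, exists M : nat, forall x y z : V,
      rigid_triple ec x y z -> d x y = n ->
      (d x y + d y z + d z x <= M)%N) y z :
  exists b, below h b y /\ below h b z.
Proof.
have [n] := ubnP (d y z); elim: n y z => // n IHn y z dyz.
apply: contrapT => nobelow.
have [M MP] := rigid (d y z).
have [F FP] := graph_ball_finite elf (d y z + M) y.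
have [x Fx] := hh F.
have yF : y \in F by apply: FP; rewrite graph_distxx.
have zF : z \in F by apply: FP; rewrite leq_addr.
have between_below a b : a \in F -> b \in F -> (d x b + d b a = d x a)%N ->
  below h b a by exact: deep_below.
(* The vertex v chosen below is the furthest from x among the vertices on
   minimal paths from x to y and from x to z. *)
pose meet k := `[< exists v, [/\ (d x v + d v y = d x y)%N,
  (d x v + d v z = d x z)%N & d x v = k] >].
have exm : exists k, meet k.
  by exists 0%N; apply/asboolP; exists x; rewrite graph_distxx.
have ubm k : meet k -> (k <= d x y)%N.
  by move=> /asboolP[v [<- _ <-]]; rewrite leq_addr.
case: (ex_maxnP exm ubm) => k /asboolP[v [vy vz vk]] kmax.
have notF : v \notin F.
  by apply/negP => vF; apply: nobelow; exists v; split; exact: between_below.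
have tri := graph_dist_triangle ec; have sym := graph_dist_sym es ec.
(* The corners y and z.  A vertex u shared there, other than the corner a, is
   below a and closer to b, so a common lower bound of u and b is one of a
   and b. *)
have corner a b u : a \in F -> u \in F -> d a b = d y z ->
    (forall c, below h c a -> below h c b -> False) ->
    (d a u + d u b = d a b)%N -> (d x u + d u a = d x a)%N -> u = a.
  move=> aF uF dab nob aub xua; apply: contrapT => ua.
  have dau : (0 < d a u)%N by rewrite lt0n; apply/eqP => /graph_dist_eq0/esym.
  have [|c [cu cb]] := IHn u b; first by lia.
  by apply: (nob c) => //; apply: below_trans cu _; exact: between_below.
suff rt : rigid_triple ec y z v.
  case/negP: notF; apply: FP.
  by have := MP _ _ _ rt erefl; rewrite (sym v y); lia.
split.
  rewrite /= !inE negb_or andbT -!andbA; apply/and3P; split; apply/eqP => E.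
  - by apply: nobelow; exists y; rewrite -E; split; exact: below_refl.
  - by move: notF; rewrite -E yF.
  - by move: notF; rewrite -E zF.
split=> p q u pP qP /(minimal_path_split pP) up /(minimal_path_split qP) uq;
  have := tri v x u; have := tri u x y; have := tri u x z;
  have := sym v y; have := sym v z; have := sym v u; have := sym u y;
  have := sym u z; have := sym y z => s6 s5 s4 s3 s2 s1 t3 t2 t1.
- apply: (@corner y z) => //; [by apply: FP; lia| |by lia].
  by move=> c cy cz; apply: nobelow; exists c.
- apply: (@corner z y) => //; [by apply: FP; lia| |by lia].
  by move=> c cz cy; apply: nobelow; exists c.
(* The corner v: a vertex shared there is also shared by minimal paths from x,
   so it cannot be further from x than v. *)
- apply/esym/(@graph_dist_eq0 _ _ ec).
  suff /kmax : meet (d x u) by lia.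
  by apply/asboolP; exists u; split; lia.
Qed.

End Horofunction.
End Geodesics.

Section Sequence.
Context (V : countType) (e : rel V) (es : symmetric e) (ec : graph_connected e).
Context (elf : locally_finite e) (h : V -> int) (hh : horofunction ec h).
Context (common : forall y z, exists b, below ec h b y /\ below ec h b z).
Local Notation d := (graph_dist ec).

(** At step n + 1 the sequence goes strictly below its last term and below the
    vertex with code n.  A vertex below all of F is deep for F when it is not in
    F, and a strictly descending sequence meets each vertex at most once. *)
Lemma busemann_sequence x0 : exists g : nat -> V,
  [/\ g 0%N = x0,
      forall m n, (m <= n)%N -> below ec h (g n) (g m),
      forall n, h (g n.+1) < h (g n) &
      forall F : seq V, \forall n \near \oo, deep ec h F (g n)].
Proof.
have step n a : exists b, [/\ below ec h b a, h b < h a &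
    forall v, unpickle n = Some v -> below ec h b v].
  have [b [ba bv]] : exists b, below ec h b a /\
      forall v, unpickle n = Some v -> below ec h b v.
    case: (unpickle n) => [v|].
      by have [b [ba bv]] := common a v; exists b; split => // _ [<-].
    by exists a; split => //; exact: below_refl.
  have [c [cb hcb]] := below_strict es hh elf b; exists c; split.
  - exact: (below_trans es hh cb ba).
  - by move: ba; rewrite /below; lia.
  - by move=> v /bv; exact: (below_trans es hh cb).
have /choice[next nextP] : forall na : nat * V, exists b,
    [/\ below ec h b na.2, h b < h na.2 &
      forall v, unpickle na.1 = Some v -> below ec h b v].
  by move=> [n a]; exact: step.
pose g := fix g n := if n is n'.+1 then next (n', g n') else x0.
have mono m n : (m <= n)%N -> below ec h (g n) (g m).
  elim: n => [|n IHn]; first by rewrite leqn0 => /eqP ->; exact: below_refl.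
  rewrite leq_eqVlt => /orP[/eqP ->|]; first exact: below_refl.
  rewrite ltnS => /IHn; apply: (below_trans es hh).
  by have [] := nextP (n, g n).
have dec n : h (g n.+1) < h (g n) by have [] := nextP (n, g n).
have evt v : \forall n \near \oo, below ec h (g n) v /\ g n != v.
  exists (pickle v).+2 => // n /= vn.
  have gv : below ec h (g (pickle v).+1) v.
    by have [_ _] := nextP (pickle v, g (pickle v)); apply; exact: pickleK.
  split; first exact: (below_trans es hh (mono _ _ (ltnW vn)) gv).
  apply/eqP => gnv; have := mono _ _ vn; have := dec (pickle v).+1.
  by move: gv; rewrite gnv /below; lia.
exists g; split => // F.
have : \forall n \near \oo, forall v, v \in F -> below ec h (g n) v /\ g n != v.
  elim: F => [|v F IHF]; first by near=> n.
  apply: filterS2 (evt v) IHF => n nv nF u; rewrite inE => /orP[/eqP ->//|].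
  exact: nF.
apply: filterS => n nF; split.
  by apply/negP => /nF[_]; rewrite eqxx.
move=> y z /nF[yb _] /nF[zb _]; move: yb zb; rewrite /below.
by rewrite !(graph_dist_sym es ec (g n)); lia.
Unshelve. all: by end_near. Qed.

End Sequence.

(** * Functions of vanishing oscillation along a filter *)

Section OscillationAlgebra.
Context {R : realType} (X : metricType R).
Local Notation C := (R[i]^o).
Implicit Types (f g : X -> C) (F : set_system X).

Lemma bounded_fun_leP f :
  bounded_fun f <-> exists2 M : C, 0 <= M & forall x, `|f x| <= M.
Proof.
split=> [[M [Mreal fM]]|[M M0 fM]]; last first.
  exists M; split=> [|N MN x _ /=]; first exact: ger0_real.
  by rewrite (le_trans (fM x))// ltW.
exists (`|M| + 1); first by rewrite addr_ge0.
move=> x; apply: fM => //; rewrite (le_lt_trans (real_ler_norm Mreal))//.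
by rewrite ltrDl.
Qed.

(** The Cauchy condition for the image of F under f, in a form that makes sense
    for every filter F, improper ones included. *)
Definition oscillation_vanishes F f : Prop :=
  forall e : C, 0 < e ->
    exists2 S, F S & forall x y, S x -> S y -> `|f x - f y| < e.

(** Continuity becomes an instance of vanishing oscillation, so that its
    stability under the algebra operations and uniform limits need not be proved
    separately. *)
Lemma continuous_oscillation f :
  continuous f <-> forall x : X, oscillation_vanishes (nbhs x) f.
Proof.
split=> [cf x e e0|oscf x].
  have e20 : 0 < e / 2 by rewrite divr_gt0.
  have /cvgrPdist_lt/(_ _ e20) fx := cf x.
  exists [set t | `|f x - f t| < e / 2] => // t u /= tx ux.
  rewrite (splitr e) (le_lt_trans (ler_distD (f x) _ _))//.
  by rewrite ltrD// -normrN opprB.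
apply/cvgrPdist_lt => e e0; have [S Sx Se] := oscf x _ e0.
apply: (filterS _ Sx) => t St; apply: Se => //.
by apply: nbhs_singleton; exact: Sx.
Qed.

Lemma oscillation_cst F (FF : Filter F) (c : C) :
  oscillation_vanishes F (fun=> c).
Proof.
move=> e e0; exists setT => [|x y _ _]; first exact: filterT.
by rewrite subrr normr0.
Qed.

Lemma oscillation_ZD F (FF : Filter F) (a : R[i]) f g :
  oscillation_vanishes F f -> oscillation_vanishes F g ->
  oscillation_vanishes F (a *: f + g).
Proof.
move=> of_ og e e0.
have a0 : 0 < `|a| + 1 :> C by rewrite ltr_wpDl.
have [|S FS Se] := of_ (e / 2 / (`|a| + 1)); first by rewrite !divr_gt0.
have [|T FT Te] := og (e / 2); first by rewrite divr_gt0.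
exists (S `&` T) => [|x y [Sx Tx] [Sy Ty]]; first exact: filterI.
have -> : (a *: f + g) x - (a *: f + g) y = a * (f x - f y) + (g x - g y).
  by rewrite /=; rewrite !fctE /GRing.scale /=; ring.
rewrite (splitr e) (le_lt_trans (ler_normD _ _))// ler_ltD ?Te//.
rewrite normrM mulrC -[leRHS](divfK (lt0r_neq0 a0)).
by rewrite ler_pM// ?(ltW (Se _ _ _ _))// lerDl.
Qed.

Lemma oscillation_M F (FF : Filter F) f g : bounded_fun f -> bounded_fun g ->
  oscillation_vanishes F f -> oscillation_vanishes F g ->
  oscillation_vanishes F (f * g).
Proof.
move=> /bounded_fun_leP[M M0 fM] /bounded_fun_leP[N N0 gN] of_ og e e0.
have M1 : 0 < M + 1 :> C by rewrite ltr_wpDl.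
have N1 : 0 < N + 1 :> C by rewrite ltr_wpDl.
have [|S FS Se] := of_ (e / 2 / (N + 1)); first by rewrite !divr_gt0.
have [|T FT Te] := og (e / 2 / (M + 1)); first by rewrite !divr_gt0.
exists (S `&` T) => [|x y [Sx Tx] [Sy Ty]]; first exact: filterI.
have -> : (f * g) x - (f * g) y = (f x - f y) * g x + (g x - g y) * f y.
  by rewrite !fctE; ring.
rewrite (splitr e) (le_lt_trans (ler_normD _ _))// !normrM.
rewrite -[X in _ < X + _](divfK (lt0r_neq0 N1)).
rewrite -[X in _ < _ + X](divfK (lt0r_neq0 M1)).
rewrite ltrD// ltr_pM// ?Se ?Te//.
  by rewrite (le_lt_trans (gN _))// ltrDl.
by rewrite (le_lt_trans (fM _))// ltrDl.
Qed.

Lemma oscillation_conj F f : oscillation_vanishes F f ->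
  oscillation_vanishes F (fun x => (f x)^*%C).
Proof.
move=> of_ e /of_[S FS Se]; exists S => // x y Sx Sy.
by rewrite -rmorphB /= normcJ Se.
Qed.

Lemma oscillation_uniform F f :
  (forall e : C, 0 < e -> exists2 g, oscillation_vanishes F g &
     forall x, `|f x - g x| < e) -> oscillation_vanishes F f.
Proof.
move=> fg e e0; have e30 : 0 < e / 3 by rewrite divr_gt0.
have [g og fge] := fg _ e30; have [S FS Se] := og _ e30.
exists S => // x y Sx Sy.
have -> : f x - f y = (f x - g x) + (g x - g y) + (g y - f y) by ring.
have -> : e = e / 3 + e / 3 + e / 3 by field.
rewrite (le_lt_trans (ler_normD _ _))// ltrD//; last by rewrite distrC.
by rewrite (le_lt_trans (ler_normD _ _))// ltrD// Se.
Qed.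

Lemma closure_uniformP (A : set (X -> C)) f :
  closure (A : set {uniform X -> C}) f <->
  forall e : C, 0 < e -> exists2 g, A g & forall x, `|f x - g x| < e.
Proof.
split=> [clf e e0|Af].
  have [|g [Ag /= gf]] :=
    clf [set g : {uniform X -> C} | forall x, `|f x - g x| < e].
    apply/uniform_nbhs; exists [set xy : C * C | ball xy.1 e xy.2]; split.
      exact: (entourage_ball C (PosNum e0)).
    by rewrite -ball_normE => g /= gE x; exact: gE.
  by exists g.
move=> B /uniform_nbhs[E [entE EB]].
have [e e0 eE] : exists2 e : C, 0 < e &
    [set xy : C * C | `|xy.1 - xy.2| < e] `<=` E.
  by move: entE; rewrite -entourage_ballE -ball_normE => -[e e0 eE]; exists e.
have [g Ag gf] := Af _ e0; exists g; split => //.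
by apply: EB => x _; apply: eE; exact: gf.
Qed.

(** For a proper filter F, the bounded continuous functions that have a limit
    along F. *)
Definition oscillation_algebra F : set (X -> C) :=
  [set f | bounded_continuous f /\ oscillation_vanishes F f].

Lemma cstar_oscillation_algebra F (FF : Filter F) :
  cstar_subalgebra (oscillation_algebra F).
Proof.
have cb f : bounded_continuous f <->
    (forall x : X, oscillation_vanishes (nbhs x) f) /\ bounded_fun f.
  by split=> -[/continuous_oscillation cf bf].
split.
- by move=> f [].
- split; last exact: oscillation_cst.
  apply/cb; split=> [x|]; first exact: oscillation_cst.
  apply/bounded_fun_leP; exists 1 => // x.
  by rewrite [(1 : X -> C) x]/(1 : C) normr1.
- move=> a f g [/cb[cf bf] of_] [/cb[cg bg] og].
  split; last exact: oscillation_ZD.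
  apply/cb; split=> [x|]; first exact: oscillation_ZD.
  move/bounded_fun_leP: bf => [M M0 fM]; move/bounded_fun_leP: bg => [N N0 gN].
  apply/bounded_fun_leP; exists (`|a| * M + N).
    by rewrite addr_ge0// mulr_ge0.
  move=> x; rewrite (le_trans (ler_normD _ _))// lerD//.
  by rewrite normrM ler_wpM2l.
- move=> f g [/cb[cf bf] of_] [/cb[cg bg] og].
  split; last exact: oscillation_M.
  apply/cb; split=> [x|]; first exact: oscillation_M.
  move/bounded_fun_leP: bf => [M M0 fM]; move/bounded_fun_leP: bg => [N N0 gN].
  apply/bounded_fun_leP; exists (M * N); first by rewrite mulr_ge0.
  by move=> x; rewrite normrM ler_pM.
- move=> f [/cb[cf /bounded_fun_leP[M M0 fM]] of_].
  split; last exact: oscillation_conj.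
  apply/cb; split=> [x|]; first exact: oscillation_conj.
  by apply/bounded_fun_leP; exists M => // x; rewrite normcJ.
- move=> f /closure_uniformP Af; split; last first.
    by apply: oscillation_uniform => e /Af[g [_ og] fg]; exists g.
  apply/cb; split=> [x|].
    by apply: oscillation_uniform => e /Af[g [/cb[cg _] _] fg]; exists g.
  have [g [/cb[_ /bounded_fun_leP[M M0 gM]] _] fg] := Af 1 ltr01.
  apply/bounded_fun_leP; exists (1 + M); first by rewrite addr_ge0.
  move=> x; rewrite -(subrK (g x) (f x)) (le_trans (ler_normD _ _))//.
  by rewrite lerD// ltW.
Qed.

End OscillationAlgebra.

(** * The algebra of the metric compactification *)

Lemma ltc_real (R : rcfType) (a b : R) : (a%:C%C < b%:C%C) = (a < b).
Proof.
by rewrite !lt_neqAle lecR; congr (~~ _ && _); apply/eqP/eqP => [[]|->].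
Qed.

Lemma normc_real (R : rcfType) (a : R) : `|a%:C%C| = `|a|%:C%C.
Proof. by rewrite normc_def /= expr0n addr0 sqrtr_sqr. Qed.

Section MetricAlgebraTheory.
Context {R : realType} (X : metricType R).
Local Notation C := (R[i]^o).
Implicit Types (f g : X -> C) (F : set_system X).

(** A filter without cluster points leaves every compact set. *)
Lemma filter_compactC F (FF : Filter F) (K : set X) :
  (forall x : X, exists2 U, nbhs x U & F (~` U)) -> compact K -> F (~` K).
Proof.
move=> Fout /compact_near_coveringP/(_ _ F (fun y x => x <> y) FF).
have H : forall x, K x -> \forall x' \near x & i \near F, x' <> i.
  move=> x _; have [U Ux FU] := Fout x; exists (U, ~` U) => //=.
  by move=> [y z] /= [Uy nUz] yz; apply: nUz; rewrite -yz.
by move=> /(_ H); apply: filterS => y Ky Kyy; exact: (Ky y).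
Qed.

Lemma dist_diff_lipschitz (y z x x' : X) :
  `|dist_diff y z x - dist_diff y z x'| <= (2 * mdist x x')%:C%C.
Proof.
rewrite /dist_diff -rmorphB normc_real lecR.
have := metric_triangle x x' y; have := metric_triangle x x' z.
have := metric_triangle x' x y; have := metric_triangle x' x z.
by rewrite (metric_sym x' x) ler_norml; move=> *; apply/andP; split; lra.
Qed.

Lemma dist_diff_bounded_continuous (y z : X) :
  bounded_continuous (dist_diff y z).
Proof.
split; last first.
  apply/bounded_fun_leP; exists (mdist y z)%:C%C => [|x].
    by rewrite ler0c mdist_ge0.
  rewrite /dist_diff normc_real lecR ler_norml.
  have := metric_triangle x y z; have := metric_triangle x z y.
  by rewrite (metric_sym z y); move=> *; apply/andP; split; lra.
move=> x; apply/cvgrPdist_lt => e e0.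
have [d d0 ->] : exists2 d : R, 0 < d & e = d%:C%C.
  exists (complex.Re e); last by rewrite RRe_real// gtr0_real.
  by rewrite -ltc_real RRe_real// gtr0_real.
have d20 : 0 < d / 2 by rewrite divr_gt0.
near=> t.
have xt : ball x (d / 2) t by near: t; exact: (nbhsx_ballx x _ d20).
rewrite (le_lt_trans (dist_diff_lipschitz _ _ _ _))// ltc_real.
by move: xt; rewrite ballEmdist /= => xt; lra.
Unshelve. all: by end_near. Qed.

Lemma vanishing_bounded_continuous f :
  vanishing_at_infinity f -> bounded_continuous f.
Proof.
move=> [cf f0]; split => //; apply/bounded_fun_leP.
have [K /compact_near_coveringP cK fK] := f0 1 ltr01.
have [M [Mreal KM]] :
    \forall M \near (pinfty_nbhs R[i]), K `<=` [set x | `|f x| <= M].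
  apply: cK => x _.
  have /cvgrPdist_lt/(_ _ ltr01) fx := cf x.
  exists ([set x' | `|f x - f x'| < 1], [set M | `|f x| + 1 < M]) => /=.
    split => //; exists (`|f x| + 1).
    by split => //; rewrite ger0_real// addr_ge0.
  move=> [x' M] /= [xx' xM]; rewrite (le_trans _ (ltW xM))// -lerBlDl.
  by rewrite (le_trans (lerB_dist _ _))// distrC ltW.
exists (`|M| + 2); first by rewrite addr_ge0.
move=> x; have [Kx|nKx] := pselect (K x).
  by apply: KM => //; rewrite (le_lt_trans (real_ler_norm Mreal))// ltrDl.
by rewrite (le_trans (ltW (fK _ nKx)))// -{1}[1]add0r lerD// ler1n.
Qed.

(** Convergence along F holds on the whole algebra as soon as F goes to infinity
    and all differences of distances converge along F: these are the
    generators. *)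
Lemma metric_algebra_oscillation F (FF : Filter F) :
  (forall x : X, exists2 U, nbhs x U & F (~` U)) ->
  (forall y z : X, oscillation_vanishes F (dist_diff y z)) ->
  @metric_algebra_set R X `<=` oscillation_algebra F.
Proof.
move=> Fout Fdist f; apply; split; first exact: cstar_oscillation_algebra.
move=> g [[Cg|[c _ <-]]|[[y z] _ <-]].
- split; first exact: vanishing_bounded_continuous.
  move=> e e0; have e20 : 0 < e / 2 by rewrite divr_gt0.
  have [K cK gK] := Cg.2 _ e20.
  exists (~` K); first exact: filter_compactC.
  move=> x y Kx Ky; rewrite (splitr e) (le_lt_trans (ler_normB _ _))//.
  by rewrite ltrD// gK.
- split; last exact: oscillation_cst.
  split; first exact: cst_continuous.
  by apply/bounded_fun_leP; exists `|c|.
- by split; [exact: dist_diff_bounded_continuous|exact: Fdist].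
Qed.

(** That the generated algebra consists of bounded continuous functions, and is
    thus itself a C*-algebra, is the previous lemma for the improper filter,
    whose condition at infinity is empty. *)
Lemma cstar_metric_algebra : cstar_subalgebra (@metric_algebra_set R X).
Proof.
pose F : set_system X := fun=> True.
have FF : Filter F by split.
split.
- move=> f /(@metric_algebra_oscillation F FF) []//.
    by move=> x; exists setT => //; exact: filterT.
  by move=> y z e e0; exists set0.
- by move=> A [cA GA]; exact: cstar_sub1 cA.
- move=> a f g Gf Gg A [cA GA].
  by apply: (cstar_subZD cA); [exact: Gf|exact: Gg].
- move=> f g Gf Gg A [cA GA].
  by apply: (cstar_subM cA); [exact: Gf|exact: Gg].
- by move=> f Gf A [cA GA]; apply: (cstar_sub_conj cA); exact: Gf.
- by apply: closed_bigI => A [cA _]; exact: cstar_sub_closed cA.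
Qed.

Lemma power_small (r e : C) : 0 <= r -> r < 1 -> 0 < e ->
  exists n, r ^+ n < e.
Proof.
move=> r0 r1 e0.
have re : r = (complex.Re r)%:C%C by rewrite RRe_real// ger0_real.
have ee : e = (complex.Re e)%:C%C by rewrite RRe_real// gtr0_real.
rewrite re ee in r0 r1 e0 *.
rewrite ler0c in r0; rewrite (ltc_real _ 1) in r1; rewrite (ltc_real 0) in e0.
have := @cvg_expr R (complex.Re r); rewrite ger0_norm// => /(_ r1).
move=> /cvgrPdist_lt/(_ _ e0) [n _ /(_ n (leqnn n))].
rewrite sub0r normrN ger0_norm ?exprn_ge0// => rn; exists n.
by rewrite -rmorphXn ltc_real.
Qed.

Section CstarSubalgebra.
Context (A : set (X -> C)) (cA : cstar_subalgebra A).

Lemma cstar_sub0 : A 0.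
Proof.
have := cstar_subZD cA (- 1) (cstar_sub1 cA) (cstar_sub1 cA).
by rewrite scaleN1r addNr.
Qed.

Lemma cstar_subZ (a : R[i]) f : A f -> A (a *: f).
Proof.
move=> Af; rewrite -[_ *: _]addr0.
by apply: (cstar_subZD cA) => //; exact: cstar_sub0.
Qed.

(** With N an upper bound of f, the inverse of f is 1/N times the sum of the
    powers of v = 1 - f / N.  As 0 <= v <= r < 1 with r = 1 - c / N, this
    Neumann series converges uniformly. *)
Lemma cstar_inv f (c : C) : A f -> 0 < c -> (forall x, c <= f x) ->
  A (fun x => (f x)^-1).
Proof.
move=> Af c0 cf.
have [_ /bounded_fun_leP[M M0 fM]] := cstar_sub_bounded_continuous cA Af.
pose N : C := M + c; have N0 : 0 < N by rewrite ltr_wpDl.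
have fx0 x : 0 < f x by exact: lt_le_trans c0 (cf x).
have fN x : f x <= N.
  apply: ler_wpDr; first exact: ltW.
  by rewrite (le_trans _ (fM x))// ger0_norm// ltW.
pose v : X -> C := (- N^-1) *: f + 1.
have Av : A v by apply: (cstar_subZD cA) => //; exact: cstar_sub1 cA.
pose r : C := 1 - c / N.
have r1 : r < 1 by rewrite ltrBlDr ltrDl divr_gt0.
have r0 : 0 <= r.
  by rewrite subr_ge0 ler_pdivrMr// mul1r /N lerDr.
have vE x : v x = 1 - f x / N by rewrite /v /= !fctE /GRing.scale /=; ring.
have v0 x : 0 <= v x by rewrite vE subr_ge0 ler_pdivrMr// mul1r.
have vr x : v x <= r by rewrite vE lerD2l lerN2 ler_pM2r ?invr_gt0.
pose s n : X -> C := fun x => \sum_(k < n) v x ^+ k.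
have As n : A (s n).
  have Avn k : A (fun x => v x ^+ k).
    elim: k => [|k IH]; first exact: cstar_sub1 cA.
    have -> : (fun x => v x ^+ k.+1) = v * (fun x => v x ^+ k).
      by apply/funext => x; rewrite exprS.
    exact: (cstar_subM cA).
  elim: n => [|n IH].
    have -> : s 0%N = 0 by apply/funext => x; rewrite /s big_ord0.
    exact: cstar_sub0.
  have -> : s n.+1 = 1 *: s n + (fun x => v x ^+ n).
    by apply/funext => x; rewrite /s big_ord_recr scale1r.
  exact: (cstar_subZD cA).
have sE n x : (f x)^-1 - N^-1 * s n x = (f x)^-1 * v x ^+ n.
  have := subrX1 (v x) n; rewrite -/(s n x).
  have -> : v x - 1 = - (f x / N) by rewrite vE; ring.
  move=> H; have -> : v x ^+ n = 1 - f x / N * s n x by rewrite -mulNr -H; ring.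
  have := lt0r_neq0 (fx0 x); have := lt0r_neq0 N0 => N1 f1.
  by field; apply/andP; split.
have : closure (A : set {uniform X -> C}) (fun x => (f x)^-1).
  apply/closure_uniformP => e e0.
  have [n rn] := power_small r0 r1 (mulr_gt0 e0 c0).
  exists (N^-1 *: s n); first exact: cstar_subZ.
  move=> x; rewrite [X in `|X|]sE normrM ger0_norm ?invr_ge0 ?ltW//.
  rewrite ger0_norm ?exprn_ge0// mulrC ltr_pdivrMr//.
  have vn : v x ^+ n <= r ^+ n by rewrite lerXn2r// nnegrE.
  by rewrite (le_lt_trans vn)// (lt_le_trans rn)// ler_wpM2l// ltW.
by rewrite -(closure_id _).1//; exact: cstar_sub_closed cA.
Qed.

End CstarSubalgebra.
End MetricAlgebraTheory.

(** * Characters *)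

Lemma le_term_sum (K : numDomainType) (I : eqType) (F : I -> K) (s : seq I) i :
  (forall j, 0 <= F j) -> i \in s -> F i <= \sum_(j <- s) F j.
Proof. by move=> F0 si; rewrite (big_rem _ si) lerDl sumr_ge0. Qed.

Section Characters.
Context {R : realType} (X : metricType R).
Local Notation C := (R[i]^o).
Local Notation G := (metric_algebra X).
Implicit Types (f g : G) (w : {ptws metric_algebra X -> C}).

Lemma metric_algebra_sub f : metric_algebra_set (val f).
Proof. exact: set_mem (valP f). Qed.

Definition metric_algebra_elt (u : X -> C) (Gu : metric_algebra_set u) : G :=
  Sub u (mem_set Gu).

Definition metric_algebra_conj f : G :=
  metric_algebra_elt
    (cstar_sub_conj (cstar_metric_algebra X) (metric_algebra_sub f)).

(** Density of the evaluations in the spectrum.  If no point x approximates w on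
    fs up to e, then g = sum of |f - w f|^2 over fs is at least e^2 everywhere,
    hence invertible in the algebra; but w g = 0, since w kills f - w f. *)
Lemma character_approx w : metric_compactification w ->
  forall (fs : seq G) (e : C), 0 < e ->
  exists x : X, forall f, f \in fs -> `|val f x - w f| < e.
Proof.
move=> [wlin [w1 wM]] fs e e0; apply: contrapT => noapprox.
have wD f g : w (f + g) = w f + w g by rewrite -[f]scale1r wlin !scale1r.
have w0 : w 0 = 0 by apply: (addrI (w 0)); rewrite -wD !addr0.
pose u f : G := (- w f) *: (1 : G) + f.
have wu f : w (u f) = 0.
  by rewrite /u wlin w1 /GRing.scale /= mulr1 addNr.
pose g : G := \sum_(f <- fs) u f * metric_algebra_conj (u f).
have uE f x : val (u f) x = val f x - w f.
  by rewrite /u /= addrC; congr (_ + _); exact: mulr1.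
have wg : w g = 0.
  rewrite /g; elim/big_ind: _ => // [a b wa wb|f _].
    by rewrite wD wa wb addr0.
  by rewrite wM wu mul0r.
have gE x : val g x = \sum_(f <- fs) `|val f x - w f| ^+ 2.
  rewrite /g (big_morph (fun h : G => (val h : X -> C) x)
    (id1 := 0) (op1 := +%R))//.
  by apply: eq_bigr => f _; rewrite sqr_normc -uE.
have gc x : e ^+ 2 <= val g x.
  rewrite gE; have [f ffs ef] : exists2 f, f \in fs & e <= `|val f x - w f|.
    apply: contrapT => nof; apply: noapprox; exists x => f ffs.
    have [//|ef] := real_ltP (normr_real (val f x - w f)) (gtr0_real e0).
    by case: nof; exists f.
  have le_f := @le_term_sum R[i] G (fun h => `|val h x - w h| ^+ 2) fs f.
  have le_e : e ^+ 2 <= `|val f x - w f| ^+ 2 by rewrite !expr2 ler_pM// ltW.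
  refine (le_trans le_e (le_f _ ffs)) => h.
  by rewrite exprn_ge0.
have := cstar_inv (cstar_metric_algebra X) (metric_algebra_sub g)
  (exprn_gt0 2 e0) gc.
move=> Gi; have : w (g * metric_algebra_elt Gi) = 1.
  rewrite -w1; congr w; apply: val_inj; apply/funext => x.
  by apply/mulfV/lt0r_neq0/(lt_le_trans _ (gc x)); rewrite exprn_gt0.
by rewrite wM wg mul0r => /esym/eqP; rewrite oner_eq0.
Qed.

End Characters.

(** * Boundary points of a graph *)

Section GraphSpace.
Context (R : realType) (V : choiceType) (e : rel V).
Context (es : symmetric e) (ec : graph_connected e).
Local Notation X := (graph_space R es ec).
Local Notation C := (R[i]^o).
Local Notation G := (metric_algebra X).
Local Notation d := (graph_dist ec).

Lemma graph_space_discrete (x : X) : nbhs x [set x].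
Proof.
apply/nbhs_ballP; exists 1 => //= y; rewrite ballEmdist /=.
by rewrite /mdist /= ltrn1 ltnS leqn0 => /eqP /graph_dist_eq0.
Qed.

Lemma graph_space_continuous (f : X -> C) : continuous f.
Proof.
move=> x B fxB; apply: filterS (graph_space_discrete x) => y ->.
exact: (nbhs_singleton fxB).
Qed.

Definition point_mass (x : X) : X -> C := fun y => (y == x)%:R.

Lemma point_mass_metric_algebra x : metric_algebra_set (point_mass x).
Proof.
move=> A [_]; apply; left; left; split; first exact: graph_space_continuous.
move=> u u0; exists [set x]; first exact: compact_set1.
by move=> y yx; rewrite /point_mass; case: eqP => // _; rewrite normr0.
Qed.

Lemma dist_diff_metric_algebra (y z : X) : metric_algebra_set (dist_diff y z).
Proof. by move=> A [_]; apply; right; exists (y, z). Qed.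

(** If m is the point mass at x, then f * m = f(x) m for all f, so a character
    with w m != 0 is the evaluation at x. *)
Lemma boundary_point_mass (w : {ptws G -> C}) x : metric_boundary w ->
  w (metric_algebra_elt (point_mass_metric_algebra x)) = 0.
Proof.
set m := metric_algebra_elt _; move=> [[wlin [w1 wM]] wX].
apply: contrapT => /eqP wm0; apply: wX; exists x => //.
apply/funext => f; apply: (mulIf wm0); rewrite -wM.
have w0 : w 0 = 0.
  have := wlin (-1) 1 1; rewrite scaleN1r addNr => ->.
  by rewrite scaleN1r addNr.
have -> : f * m = (val f x : R[i]) *: m + 0.
  rewrite addr0; apply: val_inj; apply/funext => y /=.
  change (val f y * (y == x)%:R = val f x * (y == x)%:R :> R[i]).
  by case: eqP => [->|_]; rewrite ?mulr0.
by rewrite wlin w0 addr0.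
Qed.

(** The trace on the vertices of the neighbourhoods of the point at infinity
    with horofunction h. *)
Definition deep_filter (h : V -> int) : set_system X :=
  filter_from [set: seq V] (deep ec h).

Lemma deep_filter_filter h : Filter (deep_filter h).
Proof.
apply: filter_from_filter; first by exists [::].
move=> F F' _ _; exists (F ++ F') => // x [nF Fx]; split; split.
- by apply: contra nF; rewrite mem_cat => ->.
- by move=> y z yF zF; apply: Fx; rewrite mem_cat ?yF ?zF.
- by apply: contra nF; rewrite mem_cat orbC => ->.
- by move=> y z yF zF; apply: Fx; rewrite mem_cat ?yF ?zF orbT.
Qed.

(** A horofunction determines the values at infinity of all elements of the
    algebra. *)
Lemma metric_algebra_deep_oscillation h (f : G) :
  oscillation_vanishes (deep_filter h) (val f).
Proof.
have FF := deep_filter_filter h.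
suff sub : @metric_algebra_set R X `<=` oscillation_algebra (deep_filter h).
  exact: (sub _ (metric_algebra_sub f)).2.
apply: metric_algebra_oscillation.
- move=> x; exists [set x]; first exact: graph_space_discrete.
  by exists [:: x] => // y [+ _] /= yx; rewrite yx inE eqxx.
- move=> y z u u0; exists (deep ec h [:: y; z]); first by exists [:: y; z].
  move=> x x' [_ Fx] [_ Fx']; rewrite /dist_diff.
  have yz t : ((d t y)%:Z - (d t z)%:Z = h y - h z) ->
      mdist (t : X) y - mdist (t : X) z = (h y - h z)%:~R :> R.
    by move=> <-; rewrite rmorphB /=.
  rewrite !yz ?subrr ?normr0//.
    by apply: Fx'; rewrite !inE eqxx ?orbT.
  by apply: Fx; rewrite !inE eqxx ?orbT.
Qed.

(** The function dist_diff y x0 has integer values and w is approximated by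
    evaluations, so its value under w rounds to an integer h(y), which is
    attained exactly wherever the approximation is better than 1/2.  An
    approximation better than 1/2 on the point mass of y also excludes x = y. *)
Lemma boundary_horofunction (w : {ptws G -> C}) : metric_boundary w ->
  exists h : V -> int, forall (F : seq V) (f : G) (u : C), 0 < u ->
    exists2 x : X, deep ec h F x & `|val f x - w f| < u.
Proof.
move=> wb; have [x0 _] := character_approx wb.1 [::] ltr01.
pose phi y : G := metric_algebra_elt (dist_diff_metric_algebra y x0).
pose mass y : G := metric_algebra_elt (point_mass_metric_algebra y).
have phiE x y : val (phi y) x = ((d x y)%:Z - (d x x0)%:Z)%:~R.
  rewrite /= /dist_diff /mdist /= rmorphB /= rmorphB /=.
  by rewrite !rmorph_nat.
have half0 : 0 < 2^-1 :> C by rewrite invr_gt0.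
have /choice[h hP] : forall y, exists n : int, `|n%:~R - w (phi y)| < 2^-1.
  move=> y; have [x xP] := character_approx wb.1 [:: phi y] half0.
  exists ((d x y)%:Z - (d x x0)%:Z); rewrite -phiE.
  by apply: xP; rewrite inE.
exists h => F f u u0.
have [u' u'0 [u'u u'h]] : exists2 u' : C, 0 < u' & u' <= u /\ u' <= 2^-1.
  have [le|/ltW le] := real_leP (gtr0_real u0) (gtr0_real half0).
    by exists u.
  by exists 2^-1.
have [x xP] := character_approx wb.1 (f :: map mass F ++ map phi F) u'0.
exists x; last by rewrite (lt_le_trans (xP f _))// inE eqxx.
split.
  apply/negP => xF; have := xP (mass x).
  rewrite inE mem_cat map_f ?orbT// => /(_ isT) /lt_le_trans /(_ u'h).
  rewrite boundary_point_mass// subr0 /= /point_mass eqxx normr1.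
  by move=> /lt_geF; rewrite invf_le1// ler1n.
suff H y : y \in F -> (d x y)%:Z - (d x x0)%:Z = h y.
  by move=> y z /H <- /H <-; lia.
move=> yF; apply/eqP; rewrite -subr_eq0 -absz_eq0 -leqn0 -ltnS.
have : `|((d x y)%:Z - (d x x0)%:Z - h y)%:~R : C| < 1.
  rewrite rmorphB /= -phiE (le_lt_trans (ler_distD (w (phi y)) _ _))//.
  rewrite [ltRHS](splitr 1) mul1r; apply: ltrD; last by rewrite distrC hP.
  apply: lt_le_trans (xP _ _) u'h.
  by rewrite inE mem_cat (map_f phi)// !orbT.
by rewrite -intr_norm (ltr_int _ _ 1); lia.
Qed.

End GraphSpace.

(** * Geodesic rays and the theorem *)

(** A geodesic sequence becomes a ray when it is parametrized by the distance to
    its origin; distinct indices with the same parameter give the same point. *)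
Lemma geodesic_sequence_ray (R : realType) (X : metricType R) (g : nat -> X) :
  (forall m n, (m <= n)%N ->
    mdist (g 0%N) (g m) + mdist (g m) (g n) = mdist (g 0%N) (g n)) ->
  ~ has_ubound (range (fun n => mdist (g 0%N) (g n))) ->
  exists (T : set R) (gamma : R -> X), almost_geodesic_ray T gamma /\
    forall P : set X, (\forall n \near \oo, P (g n)) ->
      \forall t \near within T (pinfty_nbhs R), P (gamma t).
Proof.
move=> geo unb; pose r n := mdist (g 0%N) (g n).
pose idx t := xget 0%N [set n | r n = t].
have rmono m n : (m <= n)%N -> r m <= r n.
  by move=> mn; rewrite /r -(geo _ _ mn) lerDl mdist_ge0.
have idxK t : range r t -> r (idx t) = t.
  by move=> [n _ nt]; apply: (@xgetPex _ 0%N [set n | r n = t]); exists n.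
have r0 : r 0%N = 0 by exact: mdistxx.
have T0 : range r 0 by exists 0%N.
exists (range r), (g \o idx); split; first split => //.
- by move=> _ [n _ <-]; exact: mdist_ge0.
- move=> u u0; exists 0%N => t s Tt Ts st _ /=.
  have -> : g (idx 0) = g 0%N.
    by apply/esym/mdist_positivity; rewrite -/(r _) idxK.
  suff -> : mdist (g (idx t)) (g (idx s)) = t - s.
    by rewrite (metric_sym (g (idx s))) -/(r _) idxK// subrK subrr normr0.
  have [le|/ltnW le] := leqP (idx s) (idx t).
    rewrite metric_sym; have := geo _ _ le; rewrite -!/(r _) !idxK// => H; lra.
  have := rmono _ _ le; rewrite !idxK// => ts.
  by have -> : t = s by [apply/eqP; rewrite eq_le ts]; rewrite mdistxx subrr.
move=> P [N _ NP]; exists (r N); split; first exact: num_real.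
move=> t Nt Tt; apply: NP => /=; rewrite leqNgt; apply/negP => /ltnW /rmono.
by rewrite idxK// leNgt Nt.
Qed.

Lemma ptws_cvg (I : Type) (T : topologicalType) (F : set_system {ptws I -> T})
    (FF : Filter F) (f : {ptws I -> T}) :
  (forall i, g i @[g --> F] --> f i) -> F --> f.
Proof.
move=> Ff; apply/cvg_sup => i U [_ [[B oB <-] Bfi] BU].
apply: filterS BU _; apply: Ff; exact: open_nbhs_nbhs.
Qed.

Theorem corollary3p2 (R : realType) (V : countType) (e : rel V)
    (es : symmetric e) (ec : graph_connected e)
    (elf : locally_finite e)
    (rigid_bound : forall n : nat, exists M : R, forall x y z : V,
      rigid_triple ec x y z -> graph_dist ec x y = n ->
      (graph_dist ec x y + graph_dist ec y z + graph_dist ec z x)%:R <= M)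
    (w : {ptws metric_algebra (graph_space R es ec) -> Cplx R}) :
  metric_boundary w -> busemann_point w.
Proof.
move=> wb; split => //.
have [h hP] := boundary_horofunction wb.
have hh : horofunction ec h.
  by move=> F; have [x Fx _] := hP F 0 1 ltr01; exists x.
have [x0 _ _] := hP [::] 0 1 ltr01.
have common y z : exists b, below ec h b y /\ below ec h b z.
  apply: common_below => // n; have [M MP] := rigid_bound n.
  exists (Num.truncn M).+1 => a b c abc abn.
  rewrite -(ler_nat R) (le_trans (MP _ _ _ abc abn))// ltW//.
  exact: truncnS_gt.
have [g [g0 gbelow gdec gdeep]] := busemann_sequence es elf hh common x0.
have [||T [gamma [ray gammaP]]] :=
  @geodesic_sequence_ray R (graph_space R es ec) g.
- move=> m n mn; rewrite /mdist /= -natrD; congr (_%:R).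
  have := gbelow _ _ mn; have := gbelow _ _ (leq0n m).
  by have := gbelow _ _ (leq0n n); rewrite /below; lia.
- have gn n : (n <= graph_dist ec (g 0%N) (g n))%N.
    have : h (g n) <= h (g 0%N) - n%:Z.
      by elim: n => [|n IHn]; [lia|have := gdec n; lia].
    by have := gbelow _ _ (leq0n n); rewrite /below; lia.
  move=> [M /(_ _ (imageT _ (Num.truncn M).+1))].
  rewrite /mdist /= leNgt => /negP; apply.
  by rewrite (lt_le_trans (truncnS_gt M))// ler_nat.
exists T, gamma; split => //.
apply: ptws_cvg => f.
apply/cvgrPdist_lt => u u0; have u20 : 0 < u / 2 by rewrite divr_gt0.
have [S [F _ FS] Sf] := metric_algebra_deep_oscillation h f u20.
have [x Fx xw] := hP F f _ u20.
apply: filterS (gammaP _ (gdeep F)) => t /FS St.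
rewrite /= (splitr u) (le_lt_trans (ler_distD (val f x) _ _))//.
apply: ltrD; first by rewrite distrC.
by apply: Sf => //; exact: FS.
Qed.
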